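(* For all positive integers $n$ and $k$, the number of valleyless sequences of positive integers of length $n$ whose maximum entry is $k$ equals $$V_{n,k}=\binom{n-1+2(k-1)}{2(k-1)}.$$
   Context: A finite sequence $s=s_1,s_2,\ldots,s_n$ of positive integers is called valleyless if for all $1\le i<j<k\le n$ one has $s_j\ge\min\{s_i,s_k\}$. $V_{n,k}$ denotes the number of valleyless sequences of positive integers of length $n$ with maximum entry $k$. *)

(* Defs.v *)
From mathcomp Require Import all_boot finmap.
From mathcomp Require Import mathcomp_extra boolp classical_sets functions.
From mathcomp Require Import cardinality.

Set Implicit Arguments.
Unset Strict Implicit.
Unset Printing Implicit Defensive.

Local Open Scope classical_set_scope.

Definition valleyless (n : nat) (s : n.-tuple nat) : Prop :=
  forall i j k : 'I_n, i < j -> j < k ->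
    minn (tnth s i) (tnth s k) <= tnth s j.

Definition valleyless_seqs (n k : nat) : set (n.-tuple nat) :=
  [set s | [/\ forall i, 0 < tnth s i, valleyless s
             & \max_(i < n) tnth s i = k]].

Arguments valleyless_seqs : clear implicits.

(* [fset_set] is meaningful only on finite sets, whence this lemma. *)
Lemma finite_valleyless_seqs (n k : nat) : finite_set (valleyless_seqs n k).
Proof.
pose f (t : n.-tuple 'I_k.+1) : n.-tuple nat := [tuple val (tnth t i) | i < n].
apply: (@sub_finite_set _ _ (f @` [set: n.-tuple 'I_k.+1])); last first.
  exact/finite_image/finite_finset.
move=> s [_ _ max_s]; exists [tuple inord (tnth s i) | i < n] => //.
apply: eq_from_tnth => i; rewrite !tnth_mktuple /= inordK // ltnS -max_s.
exact: (leq_bigmax i).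
Qed.

Definition V (n k : nat) : nat := #|` fset_set (valleyless_seqs n k)|%fset.

(* Main.v *)
Require Import Defs.
From mathcomp Require Import all_boot.
From mathcomp Require Import finmap classical_sets cardinality zify.

(** In a valleyless sequence of length [n + 1] with maximum [k + 1], each of
    the [k] superlevel sets at heights 2, ..., [k + 1] is a nonempty interval of
    positions, and these intervals are nested.  Hence their left ends increase,
    their right ends decrease, and the left ends followed by the right ends in
    reverse form a weakly increasing sequence of [2k] elements of
    {0, ..., [n]}.  Conversely, stacking the intervals whose ends are given by
    such a sequence on a bottom layer of ones recovers the valleyless
    sequence, and there are [n + 2k] choose [2k] weakly increasing
    sequences. *)

Set Implicit Arguments.
Unset Strict Implicit.
Unset Printing Implicit Defensive.

Local Open Scope classical_set_scope.

Lemma card_fset_set_image (T : finType) (U : choiceType) (f : T -> U)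
    (A : {set T}) :
  {in A &, injective f} -> #|` fset_set (f @` [set` A])|%fset = #|A|.
Proof.
move=> f_inj; rewrite [RHS]cardE -(card_in_imfset imfset_key f_inj).
by rewrite -[in RHS](set_fsetK (imfset _ _ _)) set_imfset.
Qed.

Lemma eq_from_ltn (x y : nat) : (forall m, (m < x) = (m < y)) -> x = y.
Proof.
by move=> xy; apply/eqP; rewrite eqn_leq leqNgt xy ltnn leqNgt -xy ltnn.
Qed.

Lemma ltn_sum_antitone (k : nat) (P : pred nat) (i : nat) :
    (forall a b, a <= b -> b < k -> P b -> P a) ->
  (i < \sum_(j < k) P j) = (i < k) && P i.
Proof.
elim: k => [|k IHk] P_anti; first by rewrite big_ord0.
rewrite big_ord_recr /= ltnS.
have [Pk|Pk] := boolP (P k).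
  rewrite (eq_bigr (fun=> 1)) => [|j _]; last by rewrite (P_anti j k) // ltnW.
  rewrite sum1_card card_ord addn1 ltnS; have [ik|//] := leqP i k.
  by rewrite (P_anti i k).
rewrite addn0 IHk => [|a b ab bk]; last by apply: P_anti => //; apply: ltnW.
rewrite [in RHS]leq_eqVlt; have [->|_] := eqVneq i k; last by [].
by rewrite (negPf Pk) !andbF.
Qed.

Lemma eq_interval (n a b c d : nat) : a <= b -> b < n -> c <= d -> d < n ->
  (forall p, p < n -> (a <= p <= b) = (c <= p <= d)) -> a = c /\ b = d.
Proof.
move=> ab bn cd dn ab_cd.
have an := leq_ltn_trans ab bn; have cn := leq_ltn_trans cd dn.
have := ab_cd a an; have := ab_cd b bn; have := ab_cd c cn.
by have := ab_cd d dn; lia.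
Qed.

Lemma sorted_cat_allrel (T : Type) (r : rel T) (s t : seq T) : transitive r ->
  sorted r (s ++ t) = [&& allrel r s t, sorted r s & sorted r t].
Proof. by move=> r_trans; rewrite !(sorted_pairwise r_trans) pairwise_cat. Qed.

Lemma sorted_mktuple (T : Type) (k : nat) (r : rel T) (f : 'I_k -> T) :
  {homo f : i j / i <= j >-> r i j} -> sorted r (mktuple f).
Proof.
move=> f_homo; rewrite sorted_map; apply: (sub_sorted (e := relpre val leq)).
  exact: f_homo.
by rewrite -sorted_map val_enum_ord iota_sorted.
Qed.

Definition layer (t : seq nat) (i p : nat) : bool :=
  nth 0 t i <= p <= nth 0 (rev t) i.

Definition height (k : nat) (t : seq nat) (p : nat) : nat :=
  (\sum_(i < k) layer t i p).+1.

Section SortedEnds.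

Variables (k : nat) (t : seq nat).
Hypotheses (t_sorted : sorted leq t) (size_t : size t = k + k).

Lemma leq_nth_sorted (i j : nat) : i <= j -> j < k + k ->
  nth 0 t i <= nth 0 t j.
Proof.
move=> ij jk; apply: (sorted_leq_nth leq_trans leqnn 0 t_sorted) => //.
- by rewrite inE size_t (leq_ltn_trans ij).
- by rewrite inE size_t.
Qed.

Lemma leq_layer_ends (i j : nat) : i < k -> j < k ->
  nth 0 t i <= nth 0 (rev t) j.
Proof. by move=> ik jk; rewrite nth_rev ?leq_nth_sorted; lia. Qed.

Lemma layer_antitone (p i j : nat) : i <= j -> j < k ->
  layer t j p -> layer t i p.
Proof.
move=> ij jk /andP[jp pj]; apply/andP; split.
  by apply: leq_trans jp; rewrite leq_nth_sorted //; lia.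
by apply: leq_trans pj _; rewrite !nth_rev ?leq_nth_sorted; lia.
Qed.

Lemma ltn_height (i p : nat) : (i.+1 < height k t p) = (i < k) && layer t i p.
Proof. exact: (ltn_sum_antitone (P := layer t ^~ p) _ (@layer_antitone p)). Qed.

Lemma height_leq (p : nat) : height k t p <= k.+1.
Proof. by rewrite leqNgt ltn_height ltnn. Qed.

Lemma height_peak : height k t (nth 0 t k.-1) = k.+1.
Proof.
apply/eqP; rewrite eqn_leq height_leq /=.
case: k leq_layer_ends ltn_height => // h ends_h lt_h.
by rewrite lt_h ltnSn /layer leqnn ends_h.
Qed.

Lemma height_quasiconcave (p q r : nat) : p <= q -> q <= r ->
  minn (height k t p) (height k t r) <= height k t q.
Proof.
move=> pq qr; have [h hq] : exists h, height k t q = h.+1 by eexists.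
rewrite hq leqNgt leq_min !ltn_height.
apply/negP => /andP[/andP[hk /andP[hp _]] /andP[_ /andP[_ rh]]].
have : h.+1 < height k t q.
  by rewrite ltn_height hk /layer (leq_trans hp pq) (leq_trans qr rh).
by rewrite hq ltnn.
Qed.

End SortedEnds.

Definition stack (n k : nat) (t : (k + k).-tuple 'I_n) : n.-tuple nat :=
  [tuple height k (map val t) p | p < n].

Lemma tnth_stack (n k : nat) (t : (k + k).-tuple 'I_n) (p : 'I_n) :
  tnth (stack t) p = height k (map val t) p.
Proof. exact: tnth_mktuple. Qed.

Lemma ltn_tnth_stack (n k : nat) (t : (k + k).-tuple 'I_n) (i : nat)
    (p : 'I_n) :
    sorted leq (map val t) ->
  (i.+1 < tnth (stack t) p) = (i < k) && layer (map val t) i p.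
Proof.
move=> t_sorted; rewrite tnth_stack (ltn_height t_sorted) //.
by rewrite size_map size_tuple.
Qed.

Lemma nth_map_val_ltn (n : nat) (t : seq 'I_n.+1) (i : nat) :
  nth 0 (map val t) i < n.+1.
Proof.
have [it|ti] := ltnP i (size t); last by rewrite nth_default ?size_map.
by rewrite (nth_map ord0) //; apply: ltn_ord.
Qed.

Lemma valleyless_seqs_stack (n k : nat) (t : (k + k).-tuple 'I_n.+1) :
  sorted leq (map val t) -> valleyless_seqs n.+1 k.+1 (stack t).
Proof.
move=> t_sorted; have size_t := size_tuple (map_tuple val t).
split=> [p|p q r pq qr|]; rewrite ?tnth_stack //.
  by apply: height_quasiconcave => //; apply: ltnW.
apply/eqP; rewrite eqn_leq; apply/andP; split.
  by apply/bigmax_leqP => p _; rewrite tnth_stack height_leq.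
pose peak := Ordinal (nth_map_val_ltn t k.-1).
by rewrite -(height_peak t_sorted size_t) -(tnth_stack t peak) leq_bigmax.
Qed.

Lemma stack_inj (n k : nat) (t u : (k + k).-tuple 'I_n.+1) :
    sorted leq (map val t) -> sorted leq (map val u) ->
  stack t = stack u -> t = u.
Proof.
move=> t_sorted u_sorted eq_tu.
have size_t := size_tuple (map_tuple val t).
have size_u := size_tuple (map_tuple val u).
have eq_ends i : i < k -> nth 0 (map val t) i = nth 0 (map val u) i /\
    nth 0 (rev (map val t)) i = nth 0 (rev (map val u)) i.
  move=> ik; apply: (@eq_interval n.+1).
  - exact: (leq_layer_ends t_sorted size_t).
  - by rewrite -map_rev nth_map_val_ltn.
  - exact: (leq_layer_ends u_sorted size_u).
  - by rewrite -map_rev nth_map_val_ltn.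
  move=> p pn; have := congr1 (fun s => i.+1 < tnth s (Ordinal pn)) eq_tu.
  by rewrite !ltn_tnth_stack // ik.
apply/val_inj/(inj_map val_inj)/(@eq_from_nth _ 0) => [|i].
  by rewrite size_t size_u.
have [ik _|ki] := ltnP i k; first by case: (eq_ends i ik).
rewrite size_t => ikk; have rev_ik : k + k - i.+1 < k by lia.
have [_] := eq_ends _ rev_ik.
rewrite !nth_rev ?size_t ?size_u; try lia.
by rewrite (_ : k + k - (k + k - i.+1).+1 = i); last by lia.
Qed.

Lemma superlevel_interval (n m : nat) (s : n.-tuple nat) (peak : 'I_n) :
    valleyless s -> m < tnth s peak ->
  exists ab : 'I_n * 'I_n,
    ab.1 <= ab.2 /\ forall p, (m < tnth s p) = (ab.1 <= p <= ab.2).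
Proof.
move=> s_valleyless m_peak.
case: (@arg_minnP _ peak (fun p => m < tnth s p) val m_peak) => a ma min_a.
case: (@arg_maxnP _ peak (fun p => m < tnth s p) val m_peak) => b mb max_b.
exists (a, b); split=> [|p]; first exact: min_a.
apply/idP/idP => [mp|/= /andP[]].
  by apply/andP; split; [exact: min_a|exact: max_b].
rewrite leq_eqVlt => /predU1P[/val_inj<-//|ap].
rewrite leq_eqVlt => /predU1P[/val_inj->//|pb].
by apply: leq_trans (s_valleyless a p b ap pb); rewrite leq_min ma.
Qed.

Definition ends_tuple (n k : nat) (lo hi : 'I_k -> 'I_n) :
    (k + k).-tuple 'I_n :=
  cat_tuple (mktuple lo) (rev_tuple (mktuple hi)).

Lemma val_ends_tuple (n k : nat) (lo hi : 'I_k -> 'I_n) :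
  map val (ends_tuple lo hi) = mktuple (val \o lo) ++ rev (mktuple (val \o hi)).
Proof. by rewrite /= map_cat map_rev -!map_comp. Qed.

Lemma ends_tuple_sorted (n k : nat) (lo hi : 'I_k -> 'I_n) :
    (forall i, lo i <= hi i) ->
    {homo lo : i j / i <= j} -> {homo hi : i j / i <= j >-> j <= i} ->
  sorted leq (map val (ends_tuple lo hi)).
Proof.
move=> lo_hi lo_homo hi_homo; rewrite val_ends_tuple.
rewrite (sorted_cat_allrel _ _ leq_trans) rev_sorted; apply/and3P; split.
- apply/allrelP => _ x /mapP[i _ ->]; rewrite mem_rev => /mapP[j _ ->] /=.
  have [/lo_homo lo_ij|/ltnW/hi_homo hi_ij] := leqP i j.
    exact: leq_trans lo_ij (lo_hi j).
  exact: leq_trans (lo_hi i) hi_ij.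
- exact: sorted_mktuple.
- exact: sorted_mktuple.
Qed.

Lemma layer_ends_tuple (n k : nat) (lo hi : 'I_k -> 'I_n) (i : 'I_k) (p : nat) :
  layer (map val (ends_tuple lo hi)) i p = (lo i <= p <= hi i).
Proof.
rewrite val_ends_tuple /layer rev_cat revK !nth_cat !size_tuple ltn_ord.
by rewrite !nth_mktuple.
Qed.

Lemma superlevel_ends (n k : nat) (s : n.-tuple nat) (peak : 'I_n) :
    valleyless s -> k < tnth s peak ->
  exists lo hi : 'I_k -> 'I_n,
    [/\ forall (i : 'I_k) p, (i.+1 < tnth s p) = (lo i <= p <= hi i),
       forall i, lo i <= hi i,
       {homo lo : i j / i <= j}
     & {homo hi : i j / i <= j >-> j <= i}].
Proof.
move=> s_valleyless k_peak.
have /fin_all_exists[ends endsP] (i : 'I_k) : exists ab : 'I_n * 'I_n,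
    ab.1 <= ab.2 /\ forall p, (i.+1 < tnth s p) = (ab.1 <= p <= ab.2).
  exact: superlevel_interval (leq_ltn_trans (ltn_ord i) k_peak).
pose lo i := (ends i).1; pose hi i := (ends i).2; exists lo, hi.
have superlevel (i : 'I_k) p : (i.+1 < tnth s p) = (lo i <= p <= hi i).
  by case: (endsP i) => _ ->.
have lo_hi i : lo i <= hi i by case: (endsP i).
have nested (i j : 'I_k) (p : 'I_n) : i <= j ->
    lo j <= p <= hi j -> lo i <= p <= hi i.
  by rewrite -!superlevel; apply: (@leq_ltn_trans j.+1 i.+1).
split=> // i j /nested.
  by move/(_ (lo j)); rewrite leqnn lo_hi => /(_ isT)/andP[].
by move/(_ (hi j)); rewrite leqnn lo_hi => /(_ isT)/andP[].
Qed.

Lemma stack_surj (n k : nat) (s : n.+1.-tuple nat) :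
    valleyless_seqs n.+1 k.+1 s ->
  exists2 t : (k + k).-tuple 'I_n.+1, sorted leq (map val t) & stack t = s.
Proof.
case=> s_gt0 s_valleyless max_s.
have s_leq p : tnth s p <= k.+1 by rewrite -max_s leq_bigmax.
have [|peak] := eq_bigmax (tnth s); first by rewrite card_ord.
rewrite max_s => peak_max; have k_peak : k < tnth s peak by rewrite -peak_max.
have [lo [hi [superlevel lo_hi lo_homo hi_homo]]] :=
  superlevel_ends s_valleyless k_peak.
have t_sorted := ends_tuple_sorted lo_hi lo_homo hi_homo.
exists (ends_tuple lo hi) => //; apply: eq_from_tnth => p.
apply: eq_from_ltn => -[|m]; first by rewrite tnth_stack s_gt0.
rewrite ltn_tnth_stack //; have [mk|km] := ltnP m k.
  by rewrite (superlevel (Ordinal mk)) (layer_ends_tuple _ _ (Ordinal mk)).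
by apply/esym/negbTE; rewrite -leqNgt (leq_trans (s_leq p)).
Qed.

Lemma valleyless_seqsE (n k : nat) :
  valleyless_seqs n.+1 k.+1 =
  @stack n.+1 k @`
    [set` [set t : (k + k).-tuple 'I_n.+1 | sorted leq (map val t)]%SET].
Proof.
apply/seteqP; split=> [s /stack_surj[t t_sorted <-]|_ [t + <-]].
  by exists t; rewrite //= inE.
by rewrite /= inE => /valleyless_seqs_stack.
Qed.

Theorem theorem3 (n k : nat) (n_gt0 : 0 < n) (k_gt0 : 0 < k) :
  V n k = 'C(n - 1 + 2 * (k - 1), 2 * (k - 1)).
Proof.
case: n k n_gt0 k_gt0 => [//|n] [//|k] _ _.
rewrite !subn1 /= addnC mul2n -addnn -card_sorted_tuples /V valleyless_seqsE.
by apply: card_fset_set_image => t u; rewrite !inE; apply: stack_inj.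
Qed.
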